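(* Let $\mathfrak{g}$ be a Leibniz algebra over $\Bbbk$ and let $n \in \mathbb{N}$. Then $\mathsf{f}_n T(s\mathfrak{g})$ is a subcomplex of the Leibniz complex $(T(s\mathfrak{g}), d_{\mathrm{Leib}})$. This defines an increasing, exhaustive filtration $$\mathsf{f}_0 T(s\mathfrak{g}) = \Bbbk \subset \ldots \subset \mathsf{f}_n T(s\mathfrak{g}) \subset \mathsf{f}_{n+1} T(s\mathfrak{g}) \subset \ldots \subset T(s\mathfrak{g}).$$
   Context: $\Bbbk$ is a field of characteristic zero; $\mathbb{N}$ contains $0$. Graded vector spaces are homologically $\mathbb{Z}$-graded, with the symmetric monoidal structure using Koszul signs. A (right) Leibniz algebra is a $\Bbbk$-vector space $\mathfrak{g}$ (in degree $0$) with a bilinear product satisfying $x(yz) = (xy)z - (xz)y$. For a vector space $V$, $sV$ denotes $V$ placed in homological degree $1$ and $T(sV) = \bigoplus_{n\ge 0} (sV)^{\otimes n}$ is the tensor algebra. The Leibniz complex of $\mathfrak{g}$ is $(T(s\mathfrak{g}), d_{\mathrm{Leib}})$ with $$d_{\mathrm{Leib}}(sx_1 \otimes \ldots \otimes sx_n) = \sum_{1 \le i<j\le n} (-1)^{j+1}\, sx_1 \otimes \ldots \otimes s(x_ix_j) \otimes \ldots \otimes \widehat{sx_j} \otimes \ldots \otimes sx_n .$$ $\mathsf{Lie}(sV)$ is the free graded Lie algebra on $sV$, identified with the Lie subalgebra of $T(sV)$ generated by $sV$ under the graded commutator $[X,Y] = X\otimes Y - (-1)^{|X||Y|} Y \otimes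 X$; it is the space of primitives of the Hopf algebra $T(sV)$ in which $sV$ is primitive. Primitive filtration: $\mathsf{f}_n T(sV) \subset T(sV)$ is the image of $\bigoplus_{i\le n} \mathsf{Lie}(sV)^{\otimes i}$ under multiplication in $T(sV)$, i.e. the linear span of all products of at most $n$ elements of $\mathsf{Lie}(sV)$ (the empty product being $1$). *)

(* Defs.v *)
From HB Require Import structures.
From mathcomp Require Import all_boot all_order all_algebra.
From mathcomp Require Import finmap.
From mathcomp Require Import boolp classical_sets.
From mathcomp.multinomials Require Import monalg.

Set Implicit Arguments.
Unset Strict Implicit.
Unset Printing Implicit Defensive.

Import GRing.Theory.
Local Open Scope ring_scope.
Local Open Scope classical_set_scope.
Local Open Scope quotient_scope.

Section Submodules.
Context (K : fieldType) (M : lmodType K).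

Definition is_submodule (S : set M) : Prop :=
  S 0 /\ forall (a : K) (x y : M), S x -> S y -> S (a *: x + y).

Definition lspan (A : set M) : set M := smallest is_submodule A.

Lemma lspan_submodule A : is_submodule (lspan A).
Proof.
split=> [S [[S0 _] _] //|a x y Sx Sy S [mS sAS]].
by apply: mS.2; [exact: Sx|exact: Sy].
Qed.

End Submodules.

Section TensorAlgebra.
Context (K : fieldType) (V : lmodType K).

Local Notation free := {malg K[{fmonom V}]}.
Local Notation fgen x := (<< fmu x >> : free).

Definition is_twosided_ideal (I : set free) : Prop :=
  is_submodule I /\ forall f g h : free, I g -> I (f * g * h).

Definition linearity_relator : set free :=
  [set r | exists (a : K) (x y : V),
     r = fgen (a *: x + y) - (a *: fgen x + fgen y)].

Definition tensor_ideal : {pred free} :=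
  fun f => `[< smallest is_twosided_ideal linearity_relator f >].

Lemma tensor_idealP f :
  reflect (smallest is_twosided_ideal linearity_relator f) (f \in tensor_ideal).
Proof. exact: asboolP. Qed.

Lemma tensor_ideal_ind (P : set free) :
  is_twosided_ideal P -> linearity_relator `<=` P ->
  forall f, f \in tensor_ideal -> P f.
Proof. by move=> iP sP f /tensor_idealP; apply. Qed.

Lemma tensor_ideal0 : 0 \in tensor_ideal.
Proof. by apply/tensor_idealP => I [[[I0 _] _] _]. Qed.

Lemma tensor_idealZD a f g :
  f \in tensor_ideal -> g \in tensor_ideal -> a *: f + g \in tensor_ideal.
Proof.
move=> /tensor_idealP If /tensor_idealP Ig; apply/tensor_idealP => I II.
by apply: II.1.1.2; [exact: If|exact: Ig].
Qed.

Lemma tensor_idealM f g h : g \in tensor_ideal -> f * g * h \in tensor_ideal.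
Proof.
move=> /tensor_idealP Ig; apply/tensor_idealP => I II.
by apply: II.1.2; exact: Ig.
Qed.

Lemma tensor_ideal_zmod_closed : zmod_closed tensor_ideal.
Proof.
split=> [|f g If Ig]; first exact: tensor_ideal0.
by rewrite addrC -scaleN1r tensor_idealZD.
Qed.

HB.instance Definition _ :=
  GRing.isZmodClosed.Build free tensor_ideal tensor_ideal_zmod_closed.

(* T(sV): the free associative algebra on the set V modulo the two-sided ideal
   making V -> T(sV) linear.  The suspension has no carrier of its own: V sits in
   degree 1, i.e. the homological degree is the word length. *)
Definition tensorAlg : Type := Quotient.quot tensor_ideal.

HB.instance Definition _ := GRing.Zmodule.on tensorAlg.
HB.instance Definition _ :=
  EqQuotient.copy tensorAlg (Quotient.quot tensor_ideal).

Local Notation T := tensorAlg.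
Local Notation pi := (\pi_T : free -> T).

Lemma tpi_eq f g : (pi f == pi g) = (f - g \in tensor_ideal).
Proof. by rewrite -Quotient.idealrBE. Qed.

Lemma tpiB : {morph pi : f g / f - g}.
Proof. by move=> f g; rewrite !piE. Qed.

Lemma tpiD : {morph pi : f g / f + g}.
Proof. by move=> f g; rewrite !piE. Qed.

Lemma tpi0 : pi 0 = 0.
Proof. by rewrite !piE. Qed.

Definition tone : T := pi 1.
Definition tmul := lift_op2 T ( *%R : free -> free -> free).
Definition tscale (a : K) := lift_op1 T ( *:%R a : free -> free).

Lemma repr_pi f : repr (pi f) - f \in tensor_ideal.
Proof. by rewrite -tpi_eq reprK. Qed.

Lemma tpiM f g : pi (f * g) = tmul (pi f) (pi g).
Proof.
unlock tmul; apply/eqP; rewrite eq_sym tpi_eq.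
set f' := repr _; set g' := repr _.
have -> : f' * g' - f * g = 1 * (f' - f) * g' + f * (g' - g) * 1.
  by rewrite mul1r mulr1 mulrBl mulrBr addrA subrK.
by rewrite rpredD // tensor_idealM // repr_pi.
Qed.

Lemma tpiZ a f : pi (a *: f) = tscale a (pi f).
Proof.
unlock tscale; apply/eqP; rewrite eq_sym tpi_eq -scalerBr -[_ *: _]addr0.
by rewrite tensor_idealZD ?tensor_ideal0 ?repr_pi.
Qed.

Lemma free_scaleAr a (f g : free) : a *: (f * g) = f * (a *: g).
Proof.
rewrite [in LHS](monalgE f) [in RHS](monalgE f) !mulr_suml scaler_sumr; apply: eq_bigr => k _.
rewrite (monalgE g) [in RHS]scaler_sumr !mulr_sumr scaler_sumr; apply: eq_bigr => l _.
have ZU b m : a *: (<< b *g m >> : free) = << a * b *g m >>.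
  by apply/malgP => m'; rewrite mcoeffZ !mcoeffU mulrnAr.
have UM b c m m' : (<< b *g m >> : free) * << c *g m' >> = << b * c *g mmul m m' >>.
  exact: fgmulUU.
by rewrite UM !ZU UM mulrCA.
Qed.

Lemma one_notin_tensor_ideal : 1 \notin tensor_ideal.
Proof.
apply/negP => I1.
have aug (f g : free) : (f * g)@_mone = f@_mone * g@_mone.
  exact: (rmorphM (mcoeff mone)).
have /eqP : (1 : free)@_mone = 0 :> K; last by rewrite mcoeff1 eqxx oner_eq0.
apply: (@tensor_ideal_ind [set f : free | f@_mone = 0]) I1.
- split; first split=> [|a f g /= If Ig] /=; first exact: mcoeff0.
    by rewrite mcoeffD mcoeffZ If Ig mulr0 addr0.
  by move=> f g h /= Ig; rewrite !aug Ig mulr0 mul0r.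
move=> _ [a [x [y ->]]] /=.
by rewrite mcoeffB mcoeffD mcoeffZ !mcoeffU !fm1_eq1 !mulr0n mulr0 addr0 subr0.
Qed.

Lemma tmulA : associative tmul.
Proof.
by move=> t u v; rewrite -[t]reprK -[u]reprK -[v]reprK -!tpiM mulrA.
Qed.

Lemma tmul1 : left_id tone tmul.
Proof. by move=> t; rewrite -[t]reprK -tpiM mul1r. Qed.

Lemma tmulr1 : right_id tone tmul.
Proof. by move=> t; rewrite -[t]reprK -tpiM mulr1. Qed.

Lemma tmulDl : left_distributive tmul +%R.
Proof.
move=> t u v; rewrite -[t]reprK -[u]reprK -[v]reprK.
by rewrite -tpiD -!tpiM -tpiD mulrDl.
Qed.

Lemma tmulDr : right_distributive tmul +%R.
Proof.
move=> t u v; rewrite -[t]reprK -[u]reprK -[v]reprK.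
by rewrite -tpiD -!tpiM -tpiD mulrDr.
Qed.

Lemma tone_neq0 : tone != 0.
Proof. by rewrite -tpi0 tpi_eq subr0 one_notin_tensor_ideal. Qed.

HB.instance Definition _ := GRing.Zmodule_isNzRing.Build T
  tmulA tmul1 tmulr1 tmulDl tmulDr tone_neq0.

Lemma tscaleA a b t : tscale a (tscale b t) = tscale (a * b) t.
Proof. by rewrite -[t]reprK -!tpiZ scalerA. Qed.

Lemma tscale1 : left_id 1 tscale.
Proof. by move=> t; rewrite -[t]reprK -tpiZ scale1r. Qed.

Lemma tscaleDr : right_distributive tscale +%R.
Proof.
by move=> a t u; rewrite -[t]reprK -[u]reprK -!tpiZ -!tpiD -tpiZ scalerDr.
Qed.

Lemma tscaleDl t : {morph tscale^~ t : a b / a + b}.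
Proof. by move=> a b; rewrite -[t]reprK -!tpiZ -tpiD scalerDl. Qed.

HB.instance Definition _ := GRing.Zmodule_isLmodule.Build K T
  tscaleA tscale1 tscaleDr tscaleDl.

Lemma tscaleAl (a : K) (t u : T) : a *: (t * u) = a *: t * u.
Proof.
change (tscale a (tmul t u) = tmul (tscale a t) u).
by rewrite -[t]reprK -[u]reprK -!tpiM -!tpiZ -!tpiM scalerAl.
Qed.

HB.instance Definition _ := GRing.Lmodule_isLalgebra.Build K T tscaleAl.

Lemma tscaleAr (a : K) (t u : T) : a *: (t * u) = t * (a *: u).
Proof.
change (tscale a (tmul t u) = tmul t (tscale a u)).
by rewrite -[t]reprK -[u]reprK -!tpiM -!tpiZ -!tpiM free_scaleAr.
Qed.

HB.instance Definition _ := GRing.Lalgebra_isAlgebra.Build K T tscaleAr.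

Lemma tpi_lin a f g : pi (a *: f + g) = a *: pi f + pi g.
Proof. by rewrite tpiD tpiZ. Qed.

(* x |-> sx, the inclusion of sV in T(sV). *)
Definition susp : V -> T := locked (fun x => pi (fgen x)).

Lemma susp_linear : linear susp.
Proof.
move=> a x y; apply/eqP; rewrite /susp -lock -tpi_lin tpi_eq.
by apply/tensor_idealP => I [_]; apply; exists a, x, y.
Qed.

HB.instance Definition _ := GRing.isLinear.Build K V T _ susp susp_linear.

Definition tword (w : seq V) : T := \prod_(x <- w) susp x.

Definition homog (n : nat) : set T := lspan [set tword w | w in [set w | size w = n]].

Lemma tword_pi w : tword w = pi << FMonom w >>.
Proof.
rewrite /tword; elim: w => [|x w IHw]; first by rewrite big_nil -fmoneE.
rewrite big_cons IHw /susp -lock -[LHS]tpiM; congr pi.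
by rewrite [LHS]fgmulUU mulr1 /mmul /= fmmulE fmuE.
Qed.

Lemma free_ind (P : free -> Prop) :
  P 0 -> (forall a f g, P f -> P g -> P (a *: f + g)) ->
  (forall w, P << FMonom w >>) -> forall f, P f.
Proof.
move=> P0 PZD Pw f; rewrite (monalgE f).
elim: (finmap.enum_fset _) => [|w s IHs]; first by rewrite big_nil.
rewrite big_cons.
have -> : << f@_w *g w >> = f@_w *: << w >> :> free.
  by apply/malgP => m; rewrite mcoeffZ !mcoeffU mulrnAr mulr1.
by apply: PZD => //; rewrite -[w]fmK; exact: Pw.
Qed.

Lemma tensor_ind (P : T -> Prop) :
  P 0 -> (forall a t u, P t -> P u -> P (a *: t + u)) ->
  (forall w, P (tword w)) -> forall t, P t.
Proof.
move=> P0 PZD Pw t; rewrite -[t]reprK; elim/free_ind: (repr t) => [|a f g|w].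
- by rewrite tpi0.
- by rewrite tpi_lin; exact: PZD.
- by rewrite -tword_pi.
Qed.

Section Lift.
Context (W : lmodType K) (f : seq V -> W).

Definition multilinear : Prop := forall (u v : seq V) (a : K) (x y : V),
  f (u ++ (a *: x + y) :: v) = a *: f (u ++ x :: v) + f (u ++ y :: v).

Definition free_lift (g : free) : W := \sum_(w <- msupp g) g@_w *: f w.

(* The linear map on T(sV) with value [f w] on the word [w] (see [tlift_word]);
   meaningful only when [f] is multilinear.  Locked so that unification does not
   unfold representatives. *)
Definition tlift : T -> W := locked (fun t => free_lift (repr t)).

Lemma free_liftEw (d : {fset {fmonom V}}) g : (msupp g `<=` d)%fset ->
  free_lift g = \sum_(w <- d) g@_w *: f w.
Proof.
move=> le; rewrite /free_lift (big_fset_incl _ le) => //= w _ /mcoeff_outdom ->.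
by rewrite scale0r.
Qed.

Lemma free_lift_linear : linear free_lift.
Proof.
move=> a g h; pose d := (msupp (a *: g + h) `|` (msupp g `|` msupp h))%fset.
rewrite !(@free_liftEw d) /d; last first.
- exact: fsubsetUl.
- by rewrite fsubsetU // fsubsetUl orbT.
- by rewrite fsubsetU // fsubsetUr orbT.
rewrite scaler_sumr -big_split; apply: eq_bigr => w _ /=.
by rewrite mcoeffD mcoeffZ scalerDl scalerA.
Qed.

HB.instance Definition _ :=
  GRing.isLinear.Build K free W _ free_lift free_lift_linear.

Lemma free_liftU w : free_lift << w >> = f w.
Proof. by rewrite (free_liftEw msuppU_le) big_seq_fset1 mcoeffUU scale1r. Qed.

Hypothesis fml : multilinear.

Lemma free_mulDl a (f1 f2 h : free) : (a *: f1 + f2) * h = a *: (f1 * h) + f2 * h.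
Proof. by rewrite mulrDl (scalerAl a f1 h). Qed.

Lemma free_mulDr a (f1 f2 h : free) : h * (a *: f1 + f2) = a *: (h * f1) + h * f2.
Proof. by rewrite mulrDr (free_scaleAr a h f1). Qed.

Lemma free_mulBDM a (f1 f2 f3 h k : free) :
  h * (f1 - (a *: f2 + f3)) * k = h * f1 * k - (a *: (h * f2 * k) + h * f3 * k).
Proof. by rewrite mulrBr mulrBl free_mulDr free_mulDl. Qed.

Lemma lin0 (a : K) (x y : W) : x = 0 -> y = 0 -> a *: x + y = 0.
Proof. by move=> -> ->; rewrite scaler0 addr0. Qed.

Lemma free_lift_relator (f1 f2 r : free) :
  linearity_relator r -> free_lift (f1 * r * f2) = 0.
Proof.
move=> rr; elim/free_ind: f1 => [|a g1 g2 IH1 IH2|u].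
- by rewrite !mul0r linear0.
- rewrite (free_mulDl a g1 g2 r) (free_mulDl a (g1 * r)) free_lift_linear.
  exact: lin0 IH1 IH2.
elim/free_ind: f2 => [|a g1 g2 IH1 IH2|v].
- by rewrite mulr0 linear0.
- by rewrite free_mulDr free_lift_linear; exact: lin0 IH1 IH2.
case: rr => a [x [y ->]].
have wE z : (<< FMonom u >> : free) * << fmu z >> * << FMonom v >>
            = << FMonom (u ++ z :: v) >>.
  rewrite [X in X * _]fgmulUU [LHS]fgmulUU !mulr1; congr mkmalgU.
  by rewrite /mmul /= !fmmulE fmuE -catA.
pose F z : free := << FMonom (u ++ z :: v) >>.
have -> : (<< FMonom u >> : free) * (fgen (a *: x + y) - (a *: fgen x + fgen y))
            * << FMonom v >> = F (a *: x + y) - (a *: F x + F y).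
  have sub (x1 x2 x3 y1 y2 y3 : free) : x1 = y1 -> x2 = y2 -> x3 = y3 ->
      x1 - (a *: x2 + x3) = y1 - (a *: y2 + y3) by move=> -> -> ->.
  apply: etrans (free_mulBDM _ _ _ _ _ _) _.
  apply: sub; [exact: wE|exact: wE|exact: wE].
by rewrite linearB /= free_lift_linear !free_liftU fml subrr.
Qed.

Lemma free_lift_ideal g : g \in tensor_ideal -> free_lift g = 0.
Proof.
move=> Ig; rewrite -[g]mulr1 -[g]mul1r; move: 1 {2}1.
apply: (@tensor_ideal_ind
  [set h | forall f1 f2 : free, free_lift (f1 * h * f2) = 0]) Ig.
- split; first split=> [f1 f2|a h k Ph Pk f1 f2].
  + by rewrite mulr0 mul0r linear0.
  + rewrite free_mulDr free_mulDl free_lift_linear.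
    exact: lin0 (Ph f1 f2) (Pk f1 f2).
  + move=> h1 k h2 Pk f1 f2; rewrite !mulrA -mulrA; exact: Pk.
- by move=> r rr f1 f2; exact: free_lift_relator.
Qed.

Lemma tlift_pi g : tlift (pi g) = free_lift g.
Proof.
rewrite /tlift -lock; have := free_lift_linear 1 (repr (pi g) - g) g.
by rewrite !scale1r subrK (free_lift_ideal (repr_pi g)) add0r.
Qed.

Lemma tlift_linear : linear tlift.
Proof.
by move=> a t u; rewrite -[t]reprK -[u]reprK -tpi_lin !tlift_pi linearP.
Qed.

Lemma tlift_word w : tlift (tword w) = f w.
Proof. by rewrite tword_pi tlift_pi free_liftU. Qed.

End Lift.

End TensorAlgebra.

#[key="V"]
HB.mixin Record Lmodule_isLeibniz (K : fieldType) V of GRing.Lmodule K V := {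
  leib : V -> V -> V;
  leib_linearl : forall y : V, linear (leib^~ y);
  leib_linearr : forall x : V, linear (leib x);
  leib_leibniz : forall x y z : V,
    leib x (leib y z) = leib (leib x y) z - leib (leib x z) y
}.

(* Right Leibniz algebras over K. *)
#[short(type="leibnizType")]
HB.structure Definition Leibniz (K : fieldType) :=
  {V of GRing.Lmodule K V & Lmodule_isLeibniz K V}.

Section LeibnizComplex.
Context (K : fieldType) (g : leibnizType K).
Local Notation T := (tensorAlg g).

(* Indices start at 0, so that the sign (-1)^(j+1) of the usual 1-based formula
   becomes (-1)^j. *)
Definition dLeib_word (w : seq g) : T :=
  let x := nth 0 w in
  \sum_(0 <= j < size w) \sum_(0 <= i < j)
    (-1) ^+ j *: \prod_(0 <= k < size w | k != j)
                    susp (if k == i then leib (x i) (x j) else x k).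

Definition dLeib : T -> T := tlift dLeib_word.

Lemma prod_multilinear (r : seq nat) (P : pred nat) p (F G H : nat -> T) a :
  uniq r -> p \in r -> P p -> F p = a *: G p + H p ->
  (forall k, P k -> k != p -> F k = G k) ->
  (forall k, P k -> k != p -> F k = H k) ->
  \prod_(k <- r | P k) F k =
    a *: \prod_(k <- r | P k) G k + \prod_(k <- r | P k) H k.
Proof.
move=> + + Pp Fp FG FH; elim: r => // k r IHr /= /andP[kr ur].
rewrite in_cons !big_cons; case: eqVneq => [pk _|npk /= pr].
  move: kr; rewrite -pk => kr; rewrite Pp Fp mulrDl scalerAl; congr (_ *: _ * _ + _ * _);
    rewrite big_seq_cond [RHS]big_seq_cond; apply: eq_bigr => l /andP[lr Pl];
    [apply: FG Pl _|apply: FH Pl _]; by apply: contraNneq kr => E; rewrite -E.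
rewrite (IHr ur pr); case: ifP => // Pk.
by rewrite mulrDr -scalerAr {1}FG 1?eq_sym // FH 1?eq_sym.
Qed.

Lemma nth_mid (u v : seq g) z k :
  nth 0 (u ++ z :: v) k = if k == size u then z else nth 0 (u ++ 0 :: v) k.
Proof.
case: eqVneq => [->|nk]; first by rewrite nth_cat ltnn subnn.
rewrite !nth_cat; case: ltnP => // le_uk.
by case E: (k - size u)%N => //; case/eqP: nk; apply/eqP; rewrite eqn_leq le_uk -subn_eq0 E.
Qed.

Lemma dLeib_word_multilinear : multilinear dLeib_word.
Proof.
move=> u v a x y; rewrite /dLeib_word.
have sz z : size (u ++ z :: v) = (size u + (size v).+1)%N by rewrite size_cat.
rewrite !sz scaler_sumr -big_split; set n := (_ + _)%N.
have pn : (size u < n)%N by rewrite /n addnS ltnS leq_addr.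
apply: eq_big_nat => j /andP[_ jn] /=.
rewrite scaler_sumr -big_split; apply: eq_big_nat => i /andP[_ ij] /=.
rewrite scalerA mulrC -scalerA -scalerDr; congr (_ *: _).
have nij : i != j by rewrite ltn_eqF.
apply: (@prod_multilinear _ _ (if j == size u then i else size u)).
- exact: iota_uniq.
- by rewrite mem_index_iota; case: ifP => _ //=; exact: ltn_trans ij jn.
- by case: ifP => [//|]; rewrite eq_sym => ->.
- rewrite !(nth_mid _ _ (_ + _)) !(nth_mid _ _ x) !(nth_mid _ _ y).
  case: (eqVneq j (size u)) => [ju|nj].
    by rewrite eqxx -ju (negPf nij) leib_linearr linearP.
  rewrite !eqxx; case: (eqVneq (size u) i) => _; last exact: linearP.
  by rewrite leib_linearl linearP.
- move=> k nkj; rewrite !(nth_mid _ _ (_ + _)) !(nth_mid _ _ x).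
  case: (eqVneq j (size u)) nkj => [->|nj] nkj nk.
    by rewrite (negPf nk) (negPf nkj).
  by rewrite (negPf nk); case: (eqVneq k i) => // ki; rewrite -ki (negPf nk).
- move=> k nkj; rewrite !(nth_mid _ _ (_ + _)) !(nth_mid _ _ y).
  case: (eqVneq j (size u)) nkj => [->|nj] nkj nk.
    by rewrite (negPf nk) (negPf nkj).
  by rewrite (negPf nk); case: (eqVneq k i) => // ki; rewrite -ki (negPf nk).
Qed.

HB.instance Definition _ := GRing.isLinear.Build K T T _ dLeib
  (tlift_linear dLeib_word_multilinear).

Lemma dLeib_tword w : dLeib (tword w) = dLeib_word w.
Proof. exact/tlift_word/dLeib_word_multilinear. Qed.


Definition act_word (x : g) (w : seq g) : T :=
  \sum_(0 <= i < size w) \prod_(0 <= k < size w)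
     susp (if k == i then leib (nth 0 w i) x else nth 0 w k).

(* The right action of x on T(sg), as a derivation of the tensor algebra. *)
Definition act (x : g) : T -> T := tlift (act_word x).

Lemma act_word_multilinear x : multilinear (act_word x).
Proof.
move=> u v a y z; rewrite /act_word.
have sz s : size (u ++ s :: v) = (size u + (size v).+1)%N by rewrite size_cat.
rewrite !sz scaler_sumr -big_split; set n := (_ + _)%N.
have pn : (size u < n)%N by rewrite /n addnS ltnS leq_addr.
apply: eq_big_nat => i /andP[_ ij] /=.
apply: (@prod_multilinear _ _ (size u)) => //.
- exact: iota_uniq.
- by rewrite mem_index_iota.
- rewrite !(nth_mid _ _ (_ + _)) !(nth_mid _ _ y) !(nth_mid _ _ z) !eqxx.
  case: (eqVneq (size u) i) => _; last exact: linearP.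
  by rewrite leib_linearl linearP.
- move=> k _ nk; rewrite !(nth_mid _ _ (_ + _)) !(nth_mid _ _ y) (negPf nk).
  by case: (eqVneq k i) => // ki; rewrite -ki (negPf nk).
- move=> k _ nk; rewrite !(nth_mid _ _ (_ + _)) !(nth_mid _ _ z) (negPf nk).
  by case: (eqVneq k i) => // ki; rewrite -ki (negPf nk).
Qed.

HB.instance Definition _ x := GRing.isLinear.Build K T T _ (act x)
  (tlift_linear (act_word_multilinear x)).

Lemma act_tword x w : act x (tword w) = act_word x w.
Proof. exact/tlift_word/act_word_multilinear. Qed.

Lemma tword_nth (w : seq g) : tword w = \prod_(0 <= k < size w) susp (nth 0 w k).
Proof. by rewrite /tword (big_nth 0). Qed.

Lemma tword_rcons (w : seq g) x : tword (rcons w x) = tword w * susp x.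
Proof. by rewrite /tword -cats1 big_cat big_seq1. Qed.

Lemma act0 x : act x 0 = 0.
Proof. exact: linear0. Qed.

Lemma actP x a (t u : T) : act x (a *: t + u) = a *: act x t + act x u.
Proof. exact: linearP. Qed.

Lemma actD x (t u : T) : act x (t + u) = act x t + act x u.
Proof. exact: linearD. Qed.

Lemma actZ x a (t : T) : act x (a *: t) = a *: act x t.
Proof. exact: linearZ. Qed.

Lemma suspB (x y : g) : susp (x - y) = susp x - susp y.
Proof. exact: linearB. Qed.

Lemma dLeib0 : dLeib 0 = 0.
Proof. exact: linear0. Qed.

Lemma dLeibP a (t u : T) : dLeib (a *: t + u) = a *: dLeib t + dLeib u.
Proof. exact: linearP. Qed.

Lemma dLeibD (t u : T) : dLeib (t + u) = dLeib t + dLeib u.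
Proof. exact: linearD. Qed.

Lemma dLeibZ a (t : T) : dLeib (a *: t) = a *: dLeib t.
Proof. exact: linearZ. Qed.

Lemma tmulP a (t u v : T) : (a *: t + u) * v = a *: (t * v) + u * v.
Proof. by rewrite mulrDl (scalerAl a t v). Qed.

Lemma act_rcons x (t : T) (y : g) :
  act x (t * susp y) = act x t * susp y + t * susp (leib y x).
Proof.
elim/tensor_ind: t => [|a t u IHt IHu|w].
- by rewrite !mul0r act0 mul0r addr0.
- by rewrite !tmulP !actP tmulP IHt IHu scalerDr addrACA.
rewrite -tword_rcons !act_tword /act_word size_rcons big_nat_recr //=.
congr (_ + _).
  rewrite mulr_suml; apply: eq_big_nat => i /= iw.
  rewrite big_nat_recr //= gtn_eqF // !nth_rcons iw ltnn eqxx; congr (_ * _).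
  by apply: eq_big_nat => k /= kw; rewrite nth_rcons kw.
rewrite big_nat_recr //= eqxx nth_rcons ltnn eqxx tword_nth; congr (_ * _).
by apply: eq_big_nat => k /= kw; rewrite nth_rcons kw ltn_eqF.
Qed.

Lemma homog_tword (w : seq g) : homog (size w) (tword w).
Proof. by apply: (sub_smallest (@subset_refl _ _)); exists w. Qed.

Lemma dLeib_word_rcons (w : seq g) x :
  dLeib_word (rcons w x) =
  dLeib_word w * susp x + (-1) ^+ size w *: act_word x w.
Proof.
rewrite /dLeib_word size_rcons big_nat_recr //=; congr (_ + _).
  rewrite mulr_suml; apply: eq_big_nat => j /= jw.
  rewrite mulr_suml; apply: eq_big_nat => i /= ij.
  have iw : (i < size w)%N by exact: ltn_trans jw.
  rewrite -scalerAl big_mkcond big_nat_recr //= -big_mkcond.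
  rewrite (gtn_eqF jw) (gtn_eqF iw) !nth_rcons jw iw ltnn eqxx.
  congr (_ *: (_ * _)).
  rewrite big_nat_cond [RHS]big_nat_cond.
  by apply: eq_bigr => k /andP[/= kw _]; rewrite nth_rcons kw.
rewrite scaler_sumr; apply: eq_big_nat => i /= iw; congr (_ *: _).
rewrite big_mkcond big_nat_recr //= eqxx mulr1; apply: eq_big_nat => k /= kw.
by rewrite !nth_rcons kw iw ltnn eqxx neq_ltn kw.
Qed.

Lemma homog_ind n (P : T -> Prop) :
  P 0 -> (forall a t u, P t -> P u -> P (a *: t + u)) ->
  (forall w, size w = n -> P (tword w)) -> forall t : T, homog n t -> P t.
Proof.
by move=> P0 PZD Pw t; apply: smallest_sub => // _ [w wn <-]; exact: Pw.
Qed.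

Lemma dLeib_rcons n (t : T) x : homog n t ->
  dLeib (t * susp x) = dLeib t * susp x + (-1) ^+ n *: act x t.
Proof.
move: t; apply: homog_ind => [|a t u IHt IHu|w wn].
- by rewrite mul0r dLeib0 act0 mul0r scaler0 addr0.
- rewrite tmulP !dLeibP actP tmulP IHt IHu !scalerDr.
  by rewrite addrACA !scalerA [X in X *: act x t]mulrC.
by rewrite -wn -tword_rcons !dLeib_tword act_tword dLeib_word_rcons.
Qed.

Lemma homog0 n : homog n (0 : T).
Proof. exact: (lspan_submodule _).1. Qed.

Lemma homogP n a (t u : T) : homog n t -> homog n u -> homog n (a *: t + u).
Proof. exact: (lspan_submodule _).2. Qed.

Lemma homog_susp n (t : T) x : homog n t -> homog n.+1 (t * susp x).
Proof.
move: t; apply: homog_ind => [|a t u IHt IHu|w wn].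
- by rewrite mul0r; exact: homog0.
- by rewrite tmulP; exact: homogP.
by rewrite -tword_rcons -wn -(size_rcons w x); exact: homog_tword.
Qed.

Lemma homogZ n a (t : T) : homog n t -> homog n (a *: t).
Proof.
move=> ht; rewrite -[_ *: _]addr0.
by apply: homogP => //; exact: homog0.
Qed.

Lemma homogD n (t u : T) : homog n t -> homog n u -> homog n (t + u).
Proof. by move=> ht hu; rewrite -[t]scale1r; exact: homogP. Qed.

Lemma homog_act n x (t : T) : homog n t -> homog n (act x t).
Proof.
move: t; apply: homog_ind => [|a t u IHt IHu|w <-].
- by rewrite act0; exact: homog0.
- by rewrite actP; exact: homogP.
elim/last_ind: w => [|w y IHw].
  by rewrite act_tword /act_word big_nil; exact: homog0.
rewrite tword_rcons act_rcons size_rcons; apply: homogD; apply: homog_susp => //.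
exact: homog_tword.
Qed.

Lemma dLeib_tword0 : dLeib (tword [::] : T) = 0.
Proof. by rewrite dLeib_tword /dLeib_word big_nil. Qed.

Lemma homog_dLeib n (t : T) : homog n t -> homog n.-1 (dLeib t).
Proof.
move: t; apply: homog_ind => [|a t u IHt IHu|w <-].
- by rewrite dLeib0; exact: homog0.
- by rewrite dLeibP; exact: homogP.
elim/last_ind: w => [|w y IHw].
  by rewrite dLeib_tword0; exact: homog0.
rewrite tword_rcons (dLeib_rcons y (@homog_tword w)) size_rcons /=.
apply: homogD; last by apply: homogZ; apply: homog_act; exact: homog_tword.
case: w IHw => [_|z w IHw]; last exact: homog_susp.
by rewrite dLeib_tword0 mul0r; exact: homog0.
Qed.

Lemma act_leib x y (t : T) :
  act (leib y x) t = act x (act y t) - act y (act x t).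
Proof.
elim/tensor_ind: t => [|a t u IHt IHu|w].
- by rewrite !act0 subr0.
- by rewrite !actP IHt IHu scalerBr opprD addrACA.
elim/last_ind: w => [|w z IHw].
  by rewrite !act_tword /act_word !big_nil !act0 subr0.
rewrite tword_rcons !act_rcons !actD !act_rcons IHw leib_leibniz suspB.
have zmodE (a b c d e f : T) :
    a - b + (e - f) = a + d + (c + e) - (b + c + (d + f)).
  rewrite (addrC c e) (addrACA a d) (addrC d f) (addrACA b) (addrC d c).
  by rewrite opprD (addrACA (a + e)) subrr addr0 opprD addrACA.
by rewrite mulrBl mulrBr; exact: zmodE.
Qed.

Lemma dLeib_act x (t : T) : dLeib (act x t) = act x (dLeib t).
Proof.
elim/tensor_ind: t => [|a t u IHt IHu|w].
- by rewrite act0 dLeib0 act0.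
- by rewrite !(actP, dLeibP) IHt IHu.
elim/last_ind: w => [|w y IHw].
  by rewrite dLeib_tword0 act_tword /act_word big_nil dLeib0 act0.
have hw := @homog_tword w.
rewrite tword_rcons act_rcons dLeibD (dLeib_rcons y (homog_act x hw)).
rewrite !(dLeib_rcons _ hw) actD actZ act_rcons IHw act_leib.
by rewrite addrACA -scalerDr (addrC (act y _)) subrK.
Qed.

Lemma dLeib_dLeib (t : T) : dLeib (dLeib t) = 0.
Proof.
elim/tensor_ind: t => [|a t u IHt IHu|w].
- by rewrite !dLeib0.
- by rewrite !dLeibP IHt IHu scaler0 addr0.
elim/last_ind: w => [|w x IHw]; first by rewrite dLeib_tword0 dLeib0.
have hw := @homog_tword w.
rewrite tword_rcons (dLeib_rcons x hw) dLeibD dLeibZ dLeib_act.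
case: w hw IHw => [|y w] hw IHw.
  by rewrite dLeib_tword0 mul0r dLeib0 act0 scaler0 addr0.
rewrite (dLeib_rcons x (homog_dLeib hw)) IHw mul0r add0r /= exprS mulN1r.
by rewrite scaleNr subrr.
Qed.

(* S is the sum of its homogeneous components S `&` homog k. *)
Definition is_graded (S : set T) : Prop := forall t, S t ->
  exists (N : nat) (c : nat -> T),
    (forall k, (S `&` homog k) (c k)) /\ t = \sum_(k < N) c k.

Definition is_subcomplex (S : set T) : Prop :=
  [/\ is_submodule S, is_graded S & forall t, S t -> S (dLeib t)].

End LeibnizComplex.

Section PrimitiveFiltration.
Context (K : fieldType) (V : lmodType K).
Local Notation T := (tensorAlg V).

(* Closure under the graded commutator, which is given by this formula on
   homogeneous elements. *)
Definition is_graded_lie_subalgebra (L : set T) : Prop :=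
  is_submodule L /\
  forall (p q : nat) (X Y : T), homog p X -> homog q Y -> L X -> L Y ->
    L (X * Y - (-1) ^+ (p * q) *: (Y * X)).

Definition freeLie : set T :=
  smallest is_graded_lie_subalgebra (range (@susp K V)).

Definition primfilt (n : nat) : set T :=
  lspan [set \prod_(X <- s) X | s in
    [set s : seq T | (size s <= n)%N /\ forall X, X \in s -> freeLie X]].

End PrimitiveFiltration.

Arguments freeLie {K} V _.
Arguments primfilt {K} V n _.

(* Main.v *)
Require Import Defs.
From HB Require Import structures.
From mathcomp Require Import all_boot all_order all_algebra.
From mathcomp Require Import boolp classical_sets.

Set Implicit Arguments.
Unset Strict Implicit.
Unset Printing Implicit Defensive.

Import GRing.Theory.
Local Open Scope ring_scope.
Local Open Scope classical_set_scope.

(* Right multiplication by a generator satisfies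
     d (A * sx) = dA * sx + (-1)^|A| (A . x),
   where A |-> A . x is a degree 0 derivation preserving Lie(sg), so d is not a
   derivation.  But the obstruction
     d (A * X) - dA * X - (-1)^|A| A * dX
   vanishes when X is a homogeneous Lie element of degree at least 2: it does so
   for products of such elements, and in a bracket with generators the terms
   coming from the action cancel.  Hence d preserves Lie(sg), and splitting off
   the last factor of a product of homogeneous Lie elements shows that d does not
   increase the number of factors. *)

(** * Linear subspaces and spans *)

Section Submodules.
Context (K : fieldType) (M : lmodType K).
Implicit Types (S A : set M) (x y : M).

Lemma submoduleD S x y : is_submodule S -> S x -> S y -> S (x + y).
Proof. by move=> [_ SP] Sx Sy; rewrite -[x]scale1r; exact: SP. Qed.

Lemma submoduleZ S a x : is_submodule S -> S x -> S (a *: x).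
Proof. by move=> [S0 SP] Sx; rewrite -[_ *: _]addr0; exact: SP. Qed.

Lemma submoduleB S x y : is_submodule S -> S x -> S y -> S (x - y).
Proof.
by move=> mS Sx Sy; rewrite -scaleN1r; apply: submoduleD => //; exact: submoduleZ.
Qed.

Lemma submodule_sum S N (c : nat -> M) :
  is_submodule S -> (forall k, S (c k)) -> S (\sum_(k < N) c k).
Proof.
move=> mS Sc; elim: N => [|N IHN]; first by rewrite big_ord0; exact: mS.1.
by rewrite big_ord_recr; exact: submoduleD.
Qed.

Lemma mem_lspan A x : A x -> lspan A x.
Proof. by move=> Ax S [_]; apply. Qed.

Lemma lspan_min S A : is_submodule S -> A `<=` S -> lspan A `<=` S.
Proof. by move=> mS AS; exact: smallest_sub. Qed.

(** Serves to check a linear condition on a span on its generators only. *)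
Lemma submodule_preim (N : lmodType K) (f : M -> N) (S : set N) :
  linear f -> is_submodule S -> is_submodule (f @^-1` S).
Proof.
move=> lf mS; split=> [|a x y Sx Sy] /=; last by rewrite lf; exact: mS.2.
(* [f] is a bare function, so [f 0 = 0] is read off from linearity with scalar -1. *)
have := lf (-1) 0 0; rewrite scaler0 addr0 scaleN1r addNr => ->; exact: mS.1.
Qed.

End Submodules.

(** * Word length grading and homogeneous projections *)

Section Grading.
Context (K : fieldType) (V : lmodType K).
Local Notation T := (tensorAlg V).
Implicit Types (t u : T).

Lemma homog_submodule n : is_submodule (@homog K V n).
Proof. exact: lspan_submodule. Qed.

Lemma mul_linearl u : linear (fun t : T => t * u).
Proof. by move=> a t1 t2; rewrite mulrDl scalerAl. Qed.

Lemma mul_linearr u : linear (fun t : T => u * t).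
Proof. by move=> a t1 t2; rewrite mulrDr scalerAr. Qed.

Lemma tword_cat (v w : seq V) : tword (v ++ w) = tword v * tword w.
Proof. by rewrite /tword big_cat. Qed.

Lemma homog_word (w : seq V) : homog (size w) (tword w).
Proof. by apply: mem_lspan; exists w. Qed.

Lemma homogM p q t u : homog p t -> homog q u -> homog (p + q) (t * u).
Proof.
move=> ht hu; move: t ht; apply: lspan_min => [|_ [v /= <- <-]].
  exact: submodule_preim (mul_linearl u) (homog_submodule _).
move: u hu; apply: lspan_min => [|_ [w /= <- <-]].
  exact: submodule_preim (mul_linearr _) (homog_submodule _).
by rewrite /= -tword_cat -size_cat; exact: homog_word.
Qed.

Lemma homog1 : homog 0 (1 : T).
Proof. by have := @homog_word [::]; rewrite /tword big_nil. Qed.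

Lemma susp_homog (x : V) : homog 1 (susp x).
Proof. by have := @homog_word [:: x]; rewrite /tword big_seq1. Qed.

Lemma homog1_susp t : homog 1 t -> exists x, t = susp x.
Proof.
move: t; apply: (@lspan_min _ _ [set t | exists x, t = susp x]).
  split=> [|a _ _ [x ->] [y ->]]; first by exists 0; rewrite linear0.
  by exists (a *: x + y); rewrite linearP.
by move=> _ [[|x [|y w]] // _ <-]; exists x; rewrite /tword big_seq1.
Qed.

Definition hproj_word n (w : seq V) : T := if size w == n then tword w else 0.

Definition hproj n : T -> T := tlift (hproj_word n).

Lemma hproj_word_multilinear n : multilinear (hproj_word n).
Proof.
move=> u v a x y; rewrite /hproj_word !size_cat /=.
case: ifP => _; last by rewrite scaler0 addr0.
have tword_cons z : tword (u ++ z :: v) = tword u * (susp z * tword v) :> T.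
  by rewrite tword_cat /tword big_cons.
by rewrite !tword_cons linearP mul_linearl mul_linearr.
Qed.

HB.instance Definition _ n := GRing.isLinear.Build K T T _ (hproj n)
  (tlift_linear (hproj_word_multilinear n)).

Lemma hproj0 n : hproj n 0 = 0.
Proof. exact: linear0. Qed.

Lemma hprojP n a t u : hproj n (a *: t + u) = a *: hproj n t + hproj n u.
Proof. exact: linearP. Qed.

Lemma hproj_tword n w : hproj n (tword w) = hproj_word n w.
Proof. exact/tlift_word/hproj_word_multilinear. Qed.

Lemma hproj_homog n p t : homog p t -> hproj n t = if p == n then t else 0.
Proof.
move: t; apply: (@lspan_min _ _ [set t | hproj n t = if p == n then t else 0]).
  split=> [|a t u]; rewrite /= ?hproj0; first by case: ifP.
  by move=> ht hu; rewrite hprojP ht hu; case: ifP => _ //; rewrite scaler0 addr0.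
by move=> _ [w /= <- <-]; rewrite hproj_tword.
Qed.

Lemma homog_hproj n t : homog n (hproj n t).
Proof.
elim/tensor_ind: t => [|a t u ht hu|w].
- by rewrite hproj0; exact: (homog_submodule _).1.
- by rewrite hprojP; exact: (homog_submodule _).2.
rewrite hproj_tword /hproj_word; case: eqP => [<-|_]; first exact: homog_word.
exact: (homog_submodule _).1.
Qed.

Lemma sum_hproj t : exists N, t = \sum_(k < N) hproj k t.
Proof.
(* Any larger bound is allowed too, so that two summands can share the maximum of their bounds. *)
suff [N] : exists N, forall n, (N <= n)%N -> t = \sum_(k < n) hproj k t.
  by move=> /(_ N (leqnn N)); exists N.
elim/tensor_ind: t => [|a t u [N1 E1] [N2 E2]|w].
- by exists 0 => n _; rewrite big1 // => k _; rewrite hproj0.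
- exists (maxn N1 N2) => n; rewrite geq_max => /andP[n1 n2].
  rewrite {1}(E1 n n1) {1}(E2 n n2) scaler_sumr -big_split.
  by apply: eq_bigr => k _; rewrite hprojP.
exists (size w).+1 => n wn; rewrite (bigD1 (Ordinal wn)) //= big1 ?addr0.
  by rewrite hproj_tword /hproj_word eqxx.
move=> k; rewrite -val_eqE /= => kw.
by rewrite hproj_tword /hproj_word eq_sym (negPf kw).
Qed.

(** * Homogeneous components of Lie elements *)

Lemma freeLie_subalgebra : is_graded_lie_subalgebra (freeLie V).
Proof.
split; first split=> [L [[[L0 _] _] _] //|a X Y LX LY L sL].
  by apply: sL.1.1.2; [exact: LX|exact: LY].
move=> p q X Y hX hY LX LY L sL.
by apply: sL.1.2 => //; [exact: LX|exact: LY].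
Qed.

Lemma freeLie_submodule : is_submodule (freeLie V).
Proof. exact: freeLie_subalgebra.1. Qed.

Lemma freeLie_susp (x : V) : freeLie V (susp x).
Proof. by move=> L [_]; apply; exists x. Qed.

Lemma homog_bracket p q (X Y : T) : homog p X -> homog q Y ->
  homog (p + q) (X * Y - (-1) ^+ (p * q) *: (Y * X)).
Proof.
move=> hX hY; apply: (submoduleB (homog_submodule _)); first exact: homogM.
by apply: (submoduleZ _ (homog_submodule _)); rewrite addnC; exact: homogM.
Qed.

(** A sum of Lie elements mixes degrees, so the induction follows all components at once. A bracket
    of homogeneous elements has a single possibly nonzero component, in degree [p + q]. *)
Lemma freeLie_hproj_ind (P : nat -> set T) :
    (forall n, is_submodule (P n)) -> (forall x, P 1%N (susp x)) ->
    (forall p q X Y, homog p X -> homog q Y -> freeLie V X -> freeLie V Y ->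
       P p X -> P q Y -> P (p + q)%N (X * Y - (-1) ^+ (p * q) *: (Y * X))) ->
  forall X, freeLie V X -> forall n, freeLie V (hproj n X) /\ P n (hproj n X).
Proof.
move=> mP P1 PB.
pose Q := [set X | forall n, freeLie V (hproj n X) /\ P n (hproj n X)].
apply: (@smallest_sub _ _ _ Q).
  split; first split=> [n|a X Y LX LY n] /=.
  - by rewrite hproj0; split; [exact: freeLie_submodule.1|exact: (mP n).1].
  - have [LX1 PX] := LX n; have [LY1 PY] := LY n; rewrite hprojP.
    by split; [exact: freeLie_submodule.2|exact: (mP n).2].
  move=> p q X Y hX hY /(_ p) + /(_ q) + n /=.
  rewrite (hproj_homog _ hX) (hproj_homog _ hY) !eqxx => -[LX PX] [LY PY].
  rewrite (hproj_homog _ (homog_bracket hX hY)); case: eqP => [<-|_].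
    by split; [exact: freeLie_subalgebra.2|exact: PB].
  by split; [exact: freeLie_submodule.1|exact: (mP n).1].
move=> _ [x _ <-] n /=; rewrite (hproj_homog _ (susp_homog x)).
case: eqP => [<-|_]; first by split; [exact: freeLie_susp|exact: P1].
by split; [exact: freeLie_submodule.1|exact: (mP n).1].
Qed.

Lemma freeLie_hproj n X : freeLie V X -> freeLie V (hproj n X).
Proof.
move=> LX; have := @freeLie_hproj_ind (fun=> setT).
by move=> /(_ _ _ _ X LX n) [].
Qed.

Lemma freeLie_homog_ind (P : nat -> set T) :
    (forall n, is_submodule (P n)) -> (forall x, P 1%N (susp x)) ->
    (forall p q X Y, homog p X -> homog q Y -> freeLie V X -> freeLie V Y ->
       P p X -> P q Y -> P (p + q)%N (X * Y - (-1) ^+ (p * q) *: (Y * X))) ->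
  forall p X, homog p X -> freeLie V X -> P p X.
Proof.
move=> mP P1 PB p X hX LX.
have [_] := freeLie_hproj_ind mP P1 PB LX p.
by rewrite (hproj_homog _ hX) eqxx.
Qed.

(** * The primitive filtration and its compatibility with the grading *)

Lemma primfilt_submodule n : is_submodule (primfilt V n).
Proof. exact: lspan_submodule. Qed.

Lemma primfilt_prod n (s : seq T) : (size s <= n)%N ->
  (forall X, X \in s -> freeLie V X) -> primfilt V n (\prod_(X <- s) X).
Proof. by move=> sn Ls; apply: mem_lspan; exists s. Qed.

Lemma primfilt_leq m n : (m <= n)%N -> primfilt V m `<=` primfilt V n.
Proof.
move=> mn; apply: lspan_min; first exact: primfilt_submodule.
by move=> _ [s /= [sm Ls] <-]; apply: primfilt_prod => //; exact: leq_trans mn.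
Qed.

Lemma primfiltM n t X : primfilt V n t -> freeLie V X -> primfilt V n.+1 (t * X).
Proof.
move=> Ft LX; move: t Ft; apply: lspan_min => [|_ [s /= [sn Ls] <-]].
  exact: submodule_preim (mul_linearl X) (primfilt_submodule _).
have -> : (\prod_(Y <- s) Y) * X = \prod_(Y <- rcons s X) Y :> T.
  by rewrite -cats1 big_cat big_seq1.
apply: primfilt_prod => [|Y]; first by rewrite size_rcons.
by rewrite mem_rcons inE => /predU1P[->//|/Ls].
Qed.

Definition homog_factors (s : seq T) :=
  forall X, X \in s -> freeLie V X /\ exists p, homog p X.

(** Homogeneous components of Lie elements are Lie elements, so by multilinearity the products of
    homogeneous factors already span. *)
Lemma primfilt_homog_ind n (S : set T) : is_submodule S ->
  (forall s, (size s <= n)%N -> homog_factors s -> S (\prod_(X <- s) X)) ->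
  primfilt V n `<=` S.
Proof.
move=> mS Ss; apply: lspan_min => // _ [s /= [sn Ls] <-].
(* [r] collects the factors already replaced by a homogeneous component, [s] holds those still to be
   expanded. *)
suff H : forall r, homog_factors r -> (size (r ++ s) <= n)%N ->
    S ((\prod_(X <- r) X) * \prod_(X <- s) X).
  by have := H [::]; rewrite big_nil mul1r; apply.
elim: s {sn} Ls => [|X s IHs] Ls r hr.
  by rewrite big_nil mulr1 cats0 => rn; exact: Ss.
rewrite size_cat /= addnS -addSn big_cons => rn.
have [N EX] := sum_hproj X; rewrite {}EX mulr_suml mulr_sumr.
apply: (@submodule_sum _ _ S N (fun k =>
  (\prod_(Y <- r) Y) * (hproj k X * \prod_(Y <- s) Y))) => // k.
have -> : (\prod_(Y <- r) Y) * (hproj k X * \prod_(Y <- s) Y)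
          = (\prod_(Y <- rcons r (hproj k X)) Y) * \prod_(Y <- s) Y.
  by rewrite mulrA -cats1 big_cat big_seq1.
apply: IHs; last by rewrite size_cat size_rcons.
  by move=> Y Ys; apply: Ls; rewrite inE Ys orbT.
move=> Y; rewrite mem_rcons inE => /predU1P[->|/hr //]; split.
  by apply: freeLie_hproj; apply: Ls; rewrite inE eqxx.
by exists k; exact: homog_hproj.
Qed.

Lemma homog_prod (s : seq T) :
  homog_factors s -> exists p, homog p (\prod_(X <- s) X).
Proof.
elim: s => [|X s IHs] hs; first by rewrite big_nil; exists 0%N; exact: homog1.
have [q hq] : exists q, homog q (\prod_(Y <- s) Y).
  by apply: IHs => Y Ys; apply: hs; rewrite inE Ys orbT.
have [_ [p hp]] := hs X (mem_head _ _).
by exists (p + q)%N; rewrite big_cons; exact: homogM.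
Qed.

(** A product of homogeneous factors is homogeneous, so the projection either fixes it or kills
    it. *)
Lemma primfilt_hproj n k t : primfilt V n t -> primfilt V n (hproj k t).
Proof.
move: t; apply: primfilt_homog_ind => [|s sn hs] /=.
  apply: submodule_preim (primfilt_submodule n); exact: linearP.
have [p hp] := homog_prod hs; rewrite (hproj_homog _ hp); case: ifP => _.
  by apply: primfilt_prod => // X /hs[].
exact: (primfilt_submodule n).1.
Qed.

End Grading.

(** * The action as a derivation of Lie elements and of the filtration *)

Section LeibnizDifferential.
Context (K : fieldType) (g : leibnizType K).
Local Notation T := (tensorAlg g).
Implicit Types (A X Y : T) (x y : g).

Lemma act1 y : act y 1 = 0.
Proof.
by have := act_tword y [::]; rewrite /act_word big_nil /tword big_nil.
Qed.

Lemma act_susp x y : act y (susp x) = susp (leib x y).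
Proof. by have := act_rcons y 1 x; rewrite act1 mul0r add0r !mul1r. Qed.

Lemma act_mul x X Y : act x (X * Y) = act x X * Y + X * act x Y.
Proof.
elim/tensor_ind: Y => [|a Y Z IHY IHZ|w].
- by rewrite act0 !mulr0 act0 addr0.
- by rewrite !actP !mul_linearr actP IHY IHZ scalerDr addrACA.
elim/last_ind: w => [|w y IHw].
  by rewrite /tword big_nil act1 mulr0 !mulr1 addr0.
by rewrite tword_rcons mulrA !act_rcons IHw mulrDl mulrDr addrA -!mulrA.
Qed.

Lemma dLeib1 : dLeib (1 : T) = 0.
Proof. by have := dLeib_tword0 g; rewrite /tword big_nil. Qed.

Lemma dLeib_susp x : dLeib (susp x) = 0.
Proof.
by have := dLeib_rcons x (@homog1 K g); rewrite dLeib1 act1 mul1r mul0r scaler0 addr0.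
Qed.

(** A derivation of degree 0 turns a bracket into a sum of two brackets with the same sign
    exponent. *)
Lemma act_freeLie y X : freeLie g X -> freeLie g (act y X).
Proof.
move=> LX; have [N EX] := sum_hproj X.
suff H n Z : homog n Z -> freeLie g Z -> freeLie g (act y Z).
  rewrite EX (big_morph (act y) (actD y) (act0 y)).
  apply: (@submodule_sum _ _ (freeLie g) N (fun k => act y (hproj k X))).
    exact: freeLie_submodule.
  by move=> k; apply: (H k); [exact: homog_hproj|exact: freeLie_hproj].
move=> hZ LZ.
apply: (@freeLie_homog_ind _ _ (fun=> [set X | freeLie g (act y X)])) hZ LZ.
- by move=> _; apply: submodule_preim (@freeLie_submodule K g); exact: actP.
- by move=> x /=; rewrite act_susp; exact: freeLie_susp.
move=> p q U W hU hW LU LW aU aW /=.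
have -> : act y (U * W - (-1) ^+ (p * q) *: (W * U)) =
   (act y U * W - (-1) ^+ (p * q) *: (W * act y U)) +
   (U * act y W - (-1) ^+ (p * q) *: (act y W * U)).
  rewrite -scaleNr addrC actP !act_mul scaleNr addrC (addrC (act y W * U)).
  by rewrite scalerDr opprD addrACA.
apply: (submoduleD (@freeLie_submodule K g)); apply: (@freeLie_subalgebra K g).2 => //;
  exact: homog_act.
Qed.

(** A derivation changes one factor at a time, into another Lie element, so the number of factors is
    kept. *)
Lemma act_primfilt y n X : primfilt g n X -> primfilt g n (act y X).
Proof.
move: X; apply: lspan_min => [|_ [s /= [sn Ls] <-]].
  by apply: submodule_preim (@primfilt_submodule K g _); exact: actP.
elim/last_ind: s n sn Ls => [|s X IHs] n sn Ls.
  by rewrite big_nil act1; exact: (@primfilt_submodule K g _).1.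
case: n sn => [|n]; rewrite size_rcons // ltnS => sn.
have LX : freeLie g X by apply: Ls; rewrite mem_rcons mem_head.
have {}Ls Y : Y \in s -> freeLie g Y.
  by move=> Ys; apply: Ls; rewrite mem_rcons inE Ys orbT.
rewrite -cats1 big_cat big_seq1 act_mul.
apply: (submoduleD (@primfilt_submodule K g _)); apply: primfiltM => //.
- exact: IHs.
- exact: primfilt_prod.
- exact: act_freeLie.
Qed.

(** * The defect of the derivation rule *)

Definition defect a A X :=
  dLeib (A * X) - dLeib A * X - (-1) ^+ a *: (A * dLeib X).

Lemma defect_linear a A : linear (defect a A).
Proof.
move=> c X Y; rewrite /defect dLeibP !mul_linearr dLeibP !scalerDr.
rewrite !scalerN [_ *: (c *: _)]scalerA [_ * c]mulrC -scalerA !opprD.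
by rewrite (AC ((2*2)*2) ((1*3*5)*(2*4*6))).
Qed.

Lemma dLeibM a A X :
  dLeib (A * X) = defect a A X + dLeib A * X + (-1) ^+ a *: (A * dLeib X).
Proof. by rewrite /defect addrAC subrK subrK. Qed.

(** The defect is a Hochschild coboundary of [dLeib], up to sign; this is its cocycle identity, from
    expanding [dLeib (A * X * Y)] along both bracketings. *)
Lemma defect_mul a p A X Y : homog a A -> homog p X ->
  defect a A (X * Y) = defect (a + p) (A * X) Y + defect a A X * Y
                       - (-1) ^+ a *: (A * defect p X Y).
Proof.
move=> hA hX.
rewrite {1}/defect mulrA (dLeibM (a + p)) (dLeibM a) (dLeibM p X Y).
move: (defect (a + p) (A * X) Y) (defect a A X) (defect p X Y) => D1 D2 D3.
rewrite !mulrDl !mulrDr !scalerDr -!scalerAl -!scalerAr !scalerA -exprD !mulrA.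
(* Of the nine summands the three defect terms are kept; the other six cancel in pairs. *)
rewrite !opprD (AC (1*3*1*1*3) ((1*2*7)*((3*6)*((4*8)*(5*9))))).
by rewrite /= !subrr !addr0.
Qed.

Lemma defect_susp a A x : homog a A -> defect a A (susp x) = (-1) ^+ a *: act x A.
Proof.
move=> hA; rewrite /defect (dLeib_rcons _ hA) dLeib_susp mulr0 scaler0 subr0.
by rewrite addrC addKr.
Qed.

(** The term where [y] acts on [X] occurs in the defects of both [A * X] and [X] against [susp y],
    and cancels; only the action on [A] survives. *)
Lemma defect_mul_susp a p A X y : homog a A -> homog p X ->
  defect a A (X * susp y) =
    (-1) ^+ (a + p) *: (act y A * X) + defect a A X * susp y.
Proof.
move=> hA hX; rewrite (defect_mul _ hA hX) (defect_susp _ hX).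
rewrite (defect_susp _ (homogM hA hX)) act_mul -scalerAr scalerA -exprD.
by rewrite scalerDr (AC (2*1*1) ((1*3)*(2*4))) /= subrr addr0.
Qed.

(** Generators do not satisfy this in general: their defect is the action, up to sign. *)
Definition derivable X := forall a A, homog a A -> defect a A X = 0.

Lemma derivable_submodule : is_submodule [set X | derivable X].
Proof.
have d0 a A : is_submodule [set X | defect a A X = 0].
  apply: (submodule_preim (@defect_linear a A) (S := [set 0])).
  by split=> [//|c _ _ -> ->] /=; rewrite scaler0 addr0.
split=> [a A _|c X Y dX dY a A hA]; first exact: (d0 a A).1.
by apply: (d0 a A).2; [exact: dX|exact: dY].
Qed.

Lemma derivable_mul p X Y :
  homog p X -> derivable X -> derivable Y -> derivable (X * Y).
Proof.
move=> hX dX dY a A hA; rewrite (defect_mul _ hA hX) (dY _ _ hX).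
by rewrite (dY _ _ (homogM hA hX)) (dX _ _ hA) mulr0 mul0r scaler0 addr0 subrr.
Qed.

(** Both products have defect [act y A * X] up to sign, and the sign of the bracket makes the two
    cancel. *)
Lemma derivable_bracket_susp p X y : homog p X -> derivable X ->
  derivable (X * susp y - (-1) ^+ p *: (susp y * X)).
Proof.
move=> hX dX a A hA.
have hy : homog 1 (susp y : T) by exact: susp_homog.
rewrite addrC -scaleNr defect_linear (defect_mul_susp _ hA hX) (dX _ _ hA).
rewrite (defect_mul _ hA hy) (dX _ _ hy) (dX _ _ (homogM hA hy)).
rewrite (defect_susp _ hA) mul0r addr0 add0r mulr0 scaler0 subr0 -scalerAl.
by rewrite scalerA mulNr -exprD addnC scaleNr addNr.
Qed.

(** The base case, where neither factor need be derivable. Each of [act y A * susp x] and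
    [act x A * susp y] arises from both products, with opposite signs. *)
Lemma derivable_susp_bracket x y :
  derivable (susp x * susp y + susp y * susp x).
Proof.
move=> a A hA; rewrite -[susp x * _]scale1r defect_linear scale1r.
rewrite !(defect_mul_susp _ hA (susp_homog _)) !(defect_susp _ hA) -!scalerAl.
rewrite addn1 exprS mulN1r !scaleNr.
by rewrite (AC (2*2) ((1*4)*(3*2))) /= !addNr addr0.
Qed.

(** * The differential of a bracket *)

Lemma dLeib_susp_bracket x y :
  dLeib (susp x * susp y + susp y * susp x)
  = - susp (leib x y + leib y x).
Proof.
rewrite dLeibD !(dLeib_rcons _ (susp_homog _)) !dLeib_susp !mul0r !add0r.
by rewrite !act_susp expr1 !scaleN1r linearD opprD.
Qed.

(** The first summand is the bracket of [dLeib X], of degree [p], with [susp y]; the action term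
    comes from the right multiplication by [susp y]. *)
Lemma dLeib_bracket_susp p X y : homog p.+1 X -> derivable X ->
  dLeib (X * susp y - (-1) ^+ p.+1 *: (susp y * X))
  = (dLeib X * susp y - (-1) ^+ p *: (susp y * dLeib X))
    + (-1) ^+ p.+1 *: act y X.
Proof.
move=> hX dX; have hy : homog 1 (susp y : T) by exact: susp_homog.
rewrite addrC -scaleNr dLeibP (dLeib_rcons _ hX) (dLeibM 1) (dX _ _ hy).
rewrite dLeib_susp mul0r !add0r expr1 scaleN1r scalerN scaleNr opprK.
by rewrite exprS mulN1r !scaleNr addrA [- _ + _]addrC.
Qed.

(** On derivable elements [dLeib] is a graded derivation of the bracket. *)
Lemma dLeib_bracket p q X Y :
  homog p.+1 X -> homog q.+1 Y -> derivable X -> derivable Y ->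
  dLeib (X * Y - (-1) ^+ (p.+1 * q.+1) *: (Y * X))
  = (dLeib X * Y - (-1) ^+ (p * q.+1) *: (Y * dLeib X))
    + (-1) ^+ p.+1 *: (X * dLeib Y - (-1) ^+ (p.+1 * q) *: (dLeib Y * X)).
Proof.
move=> hX hY dX dY.
rewrite addrC -scaleNr dLeibP (dLeibM p.+1 X) (dLeibM q.+1 Y) dX // dY // !add0r.
rewrite !(scalerBr, scalerDr) !scalerA !mulNr -!exprD.
(* The exponents differ by [2 * q.+1]. *)
have -> : (-1) ^+ (p.+1 * q.+1 + q.+1) = (-1) ^+ (p * q.+1) :> K.
  by rewrite mulSn addnAC addnn exprD -signr_odd odd_double mul1r.
by rewrite -mulnS !scaleNr (AC (2*2) ((3*2)*(4*1))).
Qed.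

(** The invariant of the induction over Lie elements. Degree 1 is exempt because of the generators;
    the vanishing in degree 0 lets the other degrees be written as successors, so that [dLeib]
    lowers them properly. *)
Definition dLeib_compat p X :=
  [/\ freeLie g (dLeib X), p = 0%N -> X = 0 & p != 1%N -> derivable X].

Lemma dLeib_compat_submodule p : is_submodule [set X | dLeib_compat p X].
Proof.
split=> [|c X Y [LX X0 dX] [LY Y0 dY]]; split.
- by rewrite dLeib0; exact: (@freeLie_submodule K g).1.
- by [].
- by move=> _; exact: derivable_submodule.1.
- by rewrite dLeibP; exact: (@freeLie_submodule K g).2.
- by move=> p0; rewrite X0 // Y0 // scaler0 addr0.
- by move=> p1; apply: derivable_submodule.2; [exact: dX|exact: dY].
Qed.

Lemma dLeib_compat_susp x : dLeib_compat 1 (susp x).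
Proof.
by split=> //; rewrite dLeib_susp; exact: (@freeLie_submodule K g).1.
Qed.

Local Notation bracket p q X Y := (X * Y - (-1) ^+ (p * q) *: (Y * X)).

Lemma dLeib_compat_bracket_susp p X y : homog p X -> freeLie g X ->
  dLeib_compat p X -> dLeib_compat (p + 1) (bracket p 1%N X (susp y)).
Proof.
move=> hX LX [LdX X0 dX]; rewrite muln1.
have [p1|np1] := eqVneq p 1%N.
  move: hX; rewrite p1 => /homog1_susp[x ->]; rewrite expr1 scaleN1r opprK.
  split=> // [|_]; last exact: derivable_susp_bracket.
  rewrite dLeib_susp_bracket -linearN; exact: freeLie_susp.
have {}dX := dX np1; split; first 1 last.
- by rewrite addn1.
- by move=> _; exact: derivable_bracket_susp.
case: p {np1} X0 hX => [/(_ erefl) -> _|p _ hX].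
  by rewrite mul0r mulr0 scaler0 subr0 dLeib0; exact: (@freeLie_submodule K g).1.
rewrite dLeib_bracket_susp //; apply: (submoduleD (@freeLie_submodule K g)).
  (* The exponent is read as [p * 1], the sign of a bracket of degrees [p] and 1. *)
  rewrite -[p]muln1; apply: (@freeLie_subalgebra K g).2 => //.
  - exact: (homog_dLeib hX).
  - exact: susp_homog.
  - exact: freeLie_susp.
by apply: (submoduleZ _ (@freeLie_submodule K g)); exact: act_freeLie.
Qed.

Lemma bracketC p q X Y :
  bracket p q X Y = - (-1) ^+ (p * q) *: bracket q p Y X.
Proof.
rewrite scalerBr scalerA mulNr (mulnC q) -expr2 sqrr_sign.
by rewrite scaleN1r opprK addrC scaleNr.
Qed.

(** A factor of degree 1 is a generator, and graded antisymmetry moves it to the right. If there is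
    none, both factors are derivable, hence so are both products. *)
Lemma dLeib_compat_bracket p q X Y : homog p X -> homog q Y ->
    freeLie g X -> freeLie g Y -> dLeib_compat p X -> dLeib_compat q Y ->
  dLeib_compat (p + q) (bracket p q X Y).
Proof.
move=> hX hY LX LY cX cY.
have [q1|nq1] := eqVneq q 1%N.
  move: hY; rewrite q1 => /homog1_susp[y ->].
  exact: dLeib_compat_bracket_susp.
have [p1|np1] := eqVneq p 1%N.
  rewrite bracketC addnC; apply: (submoduleZ _ (@dLeib_compat_submodule _)).
  move: hX; rewrite p1 => /homog1_susp[x ->].
  exact: dLeib_compat_bracket_susp.
case: cX cY => LdX X0 /(_ np1) dX [LdY Y0 /(_ nq1) dY].
case: p np1 X0 hX => [_ /(_ erefl) -> _|p _ _ hX].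
  rewrite mul0r mulr0 scaler0 subr0; exact: (@dLeib_compat_submodule _).1.
case: q nq1 Y0 hY => [_ /(_ erefl) -> _|q _ _ hY].
  rewrite mul0r mulr0 scaler0 subr0; exact: (@dLeib_compat_submodule _).1.
split=> //; last first.
  move=> _; apply: (submoduleB derivable_submodule).
    exact: (derivable_mul hX).
  apply: (submoduleZ _ derivable_submodule); exact: (derivable_mul hY).
rewrite dLeib_bracket //; apply: (submoduleD (@freeLie_submodule K g)).
  by apply: (@freeLie_subalgebra K g).2 => //; exact: (homog_dLeib hX).
apply: (submoduleZ _ (@freeLie_submodule K g)).
by apply: (@freeLie_subalgebra K g).2 => //; exact: (homog_dLeib hY).
Qed.

(** * Stability of Lie elements and of the filtration under the differential *)

Lemma freeLie_dLeib_compat p X :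
  homog p X -> freeLie g X -> dLeib_compat p X.
Proof.
apply: (@freeLie_homog_ind _ _ (fun p => [set X | dLeib_compat p X])).
- exact: dLeib_compat_submodule.
- exact: dLeib_compat_susp.
- by move=> p' q U W; exact: dLeib_compat_bracket.
Qed.

(** Induction on the last factor: a generator contributes an action term, and any other homogeneous
    Lie element obeys the derivation rule. *)
Lemma dLeib_prod (s : seq T) n : (size s <= n)%N -> homog_factors s ->
  primfilt g n (dLeib (\prod_(X <- s) X)).
Proof.
elim/last_ind: s n => [|s X IHs] n sn hs.
  by rewrite big_nil dLeib1; exact: (@primfilt_submodule K g _).1.
case: n sn => [|n]; rewrite size_rcons // ltnS => sn.
have [LX [p hX]] : freeLie g X /\ exists p, homog p X.
  by apply: hs; rewrite mem_rcons mem_head.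
have {}hs : homog_factors s.
  by move=> Y Ys; apply: hs; rewrite mem_rcons inE Ys orbT.
have Fs : primfilt g n (\prod_(Y <- s) Y).
  by apply: primfilt_prod => // Y /hs[].
have [a hA] := homog_prod hs.
have -> : \prod_(Y <- rcons s X) Y = (\prod_(Y <- s) Y) * X :> T.
  by rewrite -cats1 big_cat big_seq1.
have FdA := primfiltM (IHs n sn hs) LX.
have [LdX _ dX] := freeLie_dLeib_compat hX LX.
have [p1|np1] := eqVneq p 1%N.
  move: hX FdA; rewrite p1 => /homog1_susp[x ->] FdA; rewrite (dLeib_rcons _ hA).
  apply: (submoduleD (@primfilt_submodule K g _)) => //.
  apply: (submoduleZ _ (@primfilt_submodule K g _)).
  (* The generator is absorbed by the action, so this term has one factor fewer than allowed. *)
  by apply: (primfilt_leq (leqnSn n)); exact: act_primfilt.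
rewrite (dLeibM a) (dX np1 _ _ hA) add0r.
apply: (submoduleD (@primfilt_submodule K g _)) => //.
by apply: (submoduleZ _ (@primfilt_submodule K g _)); exact: primfiltM.
Qed.

Lemma primfilt_subcomplex n : is_subcomplex (primfilt g n).
Proof.
split; first exact: primfilt_submodule.
- move=> t Ft; have [N Et] := sum_hproj t; exists N, (fun k => hproj k t).
  by split=> // k; split; [exact: primfilt_hproj|exact: homog_hproj].
move=> t; move: t; apply: primfilt_homog_ind => [|s sn hs].
  by apply: submodule_preim (@primfilt_submodule K g n); exact: dLeibP.
exact: dLeib_prod.
Qed.

End LeibnizDifferential.

(** * The bottom step and the union of the filtration *)

Lemma primfilt0 (K : fieldType) (V : lmodType K) :
  primfilt V 0 = range (fun a : K => a%:A : tensorAlg V).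
Proof.
apply/seteqP; split=> [|_ [a _ <-]].
  apply: lspan_min => [|_ [s [+ _] <-]] /=; last first.
    rewrite leqn0 => /nilP ->; rewrite big_nil.
    by exists 1 => //; rewrite scale1r.
  split=> [|c _ _ [a _ <-] [b _ <-]]; first by exists 0; rewrite ?scale0r.
  by exists (c * a + b) => //; rewrite scalerDl scalerA.
apply: (submoduleZ _ (@primfilt_submodule K V 0)).
by have := @primfilt_prod K V 0 [::]; rewrite big_nil; apply.
Qed.

Lemma primfilt_exhaustive (K : fieldType) (V : lmodType K) :
  \bigcup_n primfilt V n = [set: tensorAlg V].
Proof.
apply/seteqP; split=> // t _.
elim/tensor_ind: t => [|a t u [m _ Fm] [n _ Fn]|w].
- by exists 0%N => //; exact: (@primfilt_submodule K V 0).1.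
- exists (maxn m n) => //; apply: (@primfilt_submodule K V _).2.
    exact: primfilt_leq (leq_maxl m n) _ Fm.
  exact: primfilt_leq (leq_maxr m n) _ Fn.
(* A word is a product of as many Lie elements as it has letters, since generators are Lie
   elements. *)
exists (size w) => //.
have -> : tword w = \prod_(X <- [seq susp x | x <- w]) X :> tensorAlg V.
  by rewrite big_map.
apply: primfilt_prod => [|_ /mapP[x _ ->]]; first by rewrite size_map.
exact: freeLie_susp.
Qed.

Theorem theorem1 (K : fieldType) (K_char0 : [pchar K] =i pred0)
    (g : leibnizType K) :
  [/\ forall n : nat, is_subcomplex (primfilt g n),
      primfilt g 0 = range (fun a : K => a%:A : tensorAlg g),
      forall n : nat, primfilt g n `<=` primfilt g n.+1
    & \bigcup_n primfilt g n = [set: tensorAlg g]].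
Proof.
split.
- exact: primfilt_subcomplex.
- exact: primfilt0.
- by move=> n; exact: primfilt_leq.
- exact: primfilt_exhaustive.
Qed.
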